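(* Let $A$ be a ring and let $\mathcal{R}$ be a zero-divisor relation on $A$. Then the graph $\zeta(\mathcal{D}^*(A),\mathcal{R})$, when not empty, is connected with diameter $\leq 3$.
   Context: All rings are commutative and unitary. A graph $G=(V(G),E(G))$ consists of a set $V(G)$ of vertices and a symmetric binary relation $E(G)$ on $V(G)$ (so loops are allowed); $v,w$ are adjacent if $(v,w)\in E(G)$. An equivalence relation $\mathcal{R}$ on $A$ is called a zero-divisor relation if, whenever $a\,\mathcal{R}\,a'$ and $b\,\mathcal{R}\,b'$, one has that $ab=0$ implies $a'b'=0$. For such $\mathcal{R}$, $\zeta(A,\mathcal{R})$ is the graph with vertex set $A/\mathcal{R}$ in which $[a]$ and $[b]$ are adjacent if and only if $ab=0$ (this is well defined). For $X\subseteq A$, $\zeta(X,\mathcal{R})$ is the subgraph of $\zeta(A,\mathcal{R})$ induced by the set of vertices $\{[a]: a\in X\}$. $\mathcal{D}(A)$ is the set of zero-divisors of $A$ and $\mathcal{D}^*(A)=\mathcal{D}(A)\setminus\{0\}$. *)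

(* Defs.v *)
From Corelib Require Import RelationClasses.
From mathcomp Require Import all_boot all_algebra.
From mathcomp Require Import boolp classical_sets.

Set Implicit Arguments.
Unset Strict Implicit.
Unset Printing Implicit Defensive.

Import GRing.Theory.
Local Open Scope classical_set_scope.
Local Open Scope quotient_scope.
Local Open Scope ring_scope.

(* Loops are allowed: [adj] need not be irreflexive. *)
Record graph := Graph {
  vertex :> Type;
  adj : rel vertex;
  adj_sym : symmetric adj }.

Definition induced (G : graph) (X : set G) : graph :=
  @Graph {v : G | X v} (fun v w => adj (sval v) (sval w))
    (fun v w => adj_sym (sval v) (sval w)).

(* [p] lists the vertices after [v], so [size p] is the number of edges; the
   empty [p] joins [v] to itself. *)
Definition joins (G : graph) (v w : G) (p : seq G) : Prop :=
  path (@adj G) v p /\ last v p = w.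

Definition connected (G : graph) : Prop :=
  forall v w : G, exists p, joins v w p.

Definition is_dist (G : graph) (v w : G) (n : nat) : Prop :=
  (exists2 p, joins v w p & size p = n) /\
  (forall p, joins v w p -> (n <= size p)%N).

(* The supremum of the distances, for a connected nonempty graph; no [d]
   qualifies if the distances are unbounded. *)
Definition is_diameter (G : graph) (d : nat) : Prop :=
  (exists v w : G, is_dist v w d) /\
  (forall (v w : G) n, is_dist v w n -> (n <= d)%N).

Record zero_divisor_relation (A : comPzRingType) (R : A -> A -> Prop) : Prop :=
  ZeroDivisorRelation {
    zdr_equiv : Equivalence R;
    zdr_mul0 : forall a a' b b' : A,
      R a a' -> R b b' -> a * b = 0 -> a' * b' = 0 }.

Section Zeta.
Variables (A : comPzRingType) (R : A -> A -> Prop).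
Variable hR : zero_divisor_relation R.

Definition zdr_rel : rel A := fun a b => `[< R a b >].

Fact zdr_refl : reflexive zdr_rel.
Proof. by case: hR => -[+ _ _] _ a => h; apply/asboolP. Qed.

Fact zdr_sym : symmetric zdr_rel.
Proof.
case: hR => -[_ h _] _ a b.
by apply/asboolP/asboolP => ?; apply: h.
Qed.

Fact zdr_trans : transitive zdr_rel.
Proof.
case: hR => -[_ _ h] _ b a c /asboolP ab /asboolP bc.
by apply/asboolP; apply: h ab bc.
Qed.

Definition zdr_equiv_rel : equiv_rel A :=
  EquivRel zdr_rel zdr_refl zdr_sym zdr_trans.

Definition zdr_quot := {eq_quot zdr_equiv_rel}.

Definition zdr_class (a : A) : zdr_quot := \pi_{eq_quot zdr_equiv_rel} a.

Definition zeta_adj : rel zdr_quot := fun u v => repr u * repr v == 0.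

Fact zeta_adj_sym : symmetric zeta_adj.
Proof. by move=> u v; rewrite /zeta_adj mulrC. Qed.

Definition zeta : graph := Graph zeta_adj_sym.

Lemma zdr_classP (a b : A) : zdr_class a = zdr_class b <-> R a b.
Proof.
rewrite /zdr_class; split=> [/eqmodP/asboolP //|Rab].
by apply/eqmodP/asboolP.
Qed.

Lemma zeta_adjP (a b : A) : @adj zeta (zdr_class a) (zdr_class b) <-> a * b = 0.
Proof.
have repr_class c : R (repr (zdr_class c)) c.
  by apply/zdr_classP; rewrite /zdr_class reprK.
have class_repr c : R c (repr (zdr_class c)).
  by apply/zdr_classP; rewrite /zdr_class reprK.
split=> [/eqP|ab0]; last apply/eqP.
  exact: (zdr_mul0 hR).
exact: (zdr_mul0 hR) ab0.
Qed.

Definition zeta_on (X : set A) : graph :=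
  @induced zeta [set zdr_class a | a in X].

End Zeta.

Definition zero_divisors (A : comPzRingType) : set A :=
  [set a | exists2 b : A, b != 0 & a * b = 0].
Arguments zero_divisors A : clear implicits.

Definition nonzero_zero_divisors (A : comPzRingType) : set A :=
  zero_divisors A `\ 0.
Arguments nonzero_zero_divisors A : clear implicits.

(* Main.v *)
Require Import Defs.
From mathcomp Require Import all_boot all_algebra.
From mathcomp Require Import boolp classical_sets.

(** A vertex of the graph is the class of some nonzero [a] with [a * x = 0] for
    some nonzero [x]; such an [x] annihilates [a], so it is again a nonzero
    zero-divisor and its class is a vertex adjacent to that of [a].  Given [a]
    killed by [x] and [b] killed by [y], one of two walks exists:
    - [a - x - y - b], if [x * y = 0];
    - [a - x * y - b], if [x * y] is nonzero: both [a] and [b] kill it.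
    Adjacency of classes can be tested on any representatives, so these are
    walks in the quotient, and any two vertices are joined by at most three
    edges ([short_walk]).

    The passage to the diameter holds in any nonempty graph: if walks of length
    at most [n] join all pairs of vertices, then the distances exist and are
    bounded by [n], hence have a maximum, which is the diameter
    ([bounded_walks_diameter]). *)

Set Implicit Arguments.
Unset Strict Implicit.
Unset Printing Implicit Defensive.

Import GRing.Theory.
Local Open Scope ring_scope.

Lemma joins_is_dist (G : graph) (v w : G) (p : seq G) :
  joins v w p -> exists2 n, is_dist v w n & (n <= size p)%N.
Proof.
move=> vwp.
pose P n := `[< exists2 q, joins v w q & size q = n >].
have exP : exists n, P n by exists (size p); apply/asboolP; exists p.
case: (ex_minnP exP) => n /asboolP Pn n_min.
exists n; last by apply: n_min; apply/asboolP; exists p.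
by split=> // q vwq; apply: n_min; apply/asboolP; exists q.
Qed.

Lemma is_dist_le (G : graph) (v w : G) (p : seq G) n :
  joins v w p -> is_dist v w n -> (n <= size p)%N.
Proof. by move=> vwp [_ /(_ p vwp)]. Qed.

Lemma bounded_walks_diameter (G : graph) n :
  inhabited G ->
  (forall v w : G, exists2 p, joins v w p & (size p <= n)%N) ->
  exists2 d, is_diameter G d & (d <= n)%N.
Proof.
move=> [v0] walk.
have dist_le (v w : G) k : is_dist v w k -> (k <= n)%N.
  by have [p vwp p_le] := walk v w => /(is_dist_le vwp)/leq_trans; apply.
pose P k := `[< exists v w : G, is_dist v w k >].
have exP : exists k, P k.
  have [p /joins_is_dist[k v0k _] _] := walk v0 v0.
  by exists k; apply/asboolP; exists v0, v0.
have P_le k : P k -> (k <= n)%N by move=> /asboolP[v [w /dist_le]].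
case: (ex_maxnP exP P_le) => d Pd d_max.
exists d; last exact: P_le.
split=> [|v w k vwk]; first exact/asboolP.
by apply: d_max; apply/asboolP; exists v, w.
Qed.

Lemma annihilator_nonzero_zero_divisor (A : comPzRingType) (a x : A) :
  a != 0 -> x != 0 -> a * x = 0 -> nonzero_zero_divisors A x.
Proof.
move=> a0 x0 ax0; split; last exact/eqP.
by exists a => //; rewrite mulrC.
Qed.

Section ShortWalk.
Variables (A : comPzRingType) (R : A -> A -> Prop).
Variable hR : zero_divisor_relation R.

Definition class_vertex (X : set A) (a : A) (Xa : X a) : zeta_on hR X :=
  exist _ (zdr_class hR a) (ex_intro2 _ _ a Xa erefl).

Lemma class_vertex_surj (X : set A) (v : zeta_on hR X) :
  exists (a : A) (Xa : X a), v = class_vertex Xa.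
Proof. by case: v => u [a Xa ua]; case: u / ua; exists a, Xa. Qed.

Lemma adj_class_vertex (X : set A) (a b : A) (Xa : X a) (Xb : X b) :
  a * b = 0 -> adj (class_vertex Xa) (class_vertex Xb).
Proof. by move=> ab0; apply/(zeta_adjP hR). Qed.

(** The classes met along the walk may coincide: as loops are allowed, two
    elements of a same class whose product vanishes still give an edge, so the
    argument is uniform in [v] and [w]. *)
Lemma short_walk (v w : zeta_on hR (nonzero_zero_divisors A)) :
  exists2 p, joins v w p & (size p <= 3)%N.
Proof.
have [a [Da ->]] := class_vertex_surj v.
have [b [Db ->]] := class_vertex_surj w.
have [[x x0 ax0] /eqP a0] := Da; have [[y y0 by0] /eqP b0] := Db.
have [xy0|xy0] := eqVneq (x * y) 0.
  have Dx := annihilator_nonzero_zero_divisor a0 x0 ax0.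
  have Dy := annihilator_nonzero_zero_divisor b0 y0 by0.
  exists [:: class_vertex Dx; class_vertex Dy; class_vertex Db] => //.
  by split=> //; rewrite /path !adj_class_vertex // mulrC.
have axy0 : a * (x * y) = 0 by rewrite mulrA ax0 mul0r.
have Dxy := annihilator_nonzero_zero_divisor a0 xy0 axy0.
exists [:: class_vertex Dxy; class_vertex Db] => //.
by split=> //; rewrite /path !adj_class_vertex // -mulrA [y * b]mulrC by0 mulr0.
Qed.

End ShortWalk.

Theorem theorem2p6 (A : comPzRingType) (R : A -> A -> Prop)
    (hR : zero_divisor_relation R) :
  inhabited (zeta_on hR (nonzero_zero_divisors A)) ->
  connected (zeta_on hR (nonzero_zero_divisors A)) /\
  exists2 d : nat,
    is_diameter (zeta_on hR (nonzero_zero_divisors A)) d & (d <= 3)%N.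
Proof.
move=> inh; split; last exact: bounded_walks_diameter inh (@short_walk _ _ hR).
by move=> v w; have [p vwp _] := short_walk v w; exists p.
Qed.
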